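(* Assume that the gas network is connected, has no self-loops, and its compressors are bypassed (i.e. $\mu_k=1$ for every edge $k$). Let $\Lambda$, $R$ and $Q$ be the network matrices defined in the context. Then the $V_w\times V_w$ state matrix $$\overline A=-\Lambda^{-1}(RQ)'RQ$$ of the simplified linear system, described by $\delta=0$ and $\overline\alpha=0$, has strictly negative real eigenvalues.
   Context: Network. The gas network is modeled as a finite connected directed graph $(\mathcal E,\mathcal V)$ with edges $\mathcal E=\{1,\dots,E\}$ (pipe segments) and nodes $\mathcal V=\{1,\dots,V\}$. The nodes are partitioned into a nonempty set of supply nodes $\mathcal V_s=\{1,\dots,V_s\}$ and a nonempty set of withdrawal nodes $\mathcal V_w=\{V_s+1,\dots,V\}$, with $V_w=V-V_s$ elements. We write $k:i\mapsto j$ if edge $k$ is directed from node $i$ to node $j$. The graph is directed by assigning a positive flow direction to each edge, with the convention that edges incident to supply nodes are directed away from them. Parameters. Each edge $k$ has length $\ell_k>0$, diameter $D_k>0$, friction factor $\lambda_k>0$ and cross-sectional area $\chi_k=\pi D_k^2/4$; $\sigma>0$ is the sound speed. $L=\mathrm{diag}(\ell_k)$ and $X=\mathrm{diag}(\chi_k)$ are $E\times E$ matrices. The nominal state is given by positive withdrawal-node densities $\overline{\boldsymbol\rho}\in\mathbb R^{V_w}$ and edge mass fluxes $\overline\varphi\in\mathbb R^{E}$. Matrices. With all compressor ratios equal to $1$, $Q$ is the $E\times V_w$ matrix whose rows are indexed by edges and columns by withdrawal nodes, with $Q_{kj}=1$ if edge $k$ enters node $j$, $Q_{kj}=-1$ if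 edge $k$ leaves node $j$, and $Q_{kj}=0$ otherwise. $Q_\ell$ is its positive part (entries $+1$ kept, all other entries $0$). $\Lambda=Q_\ell' X L Q_\ell$, where $'$ denotes transpose. $R$ is the $E\times E$ diagonal matrix with positive diagonal components $$R_{kk}=\sqrt{\frac{\sigma^2\pi D_k^3\,(Q_\ell\overline{\boldsymbol\rho})_k}{4\,\ell_k\lambda_k|\overline\varphi_k|}},\qquad k\in\mathcal E .$$ Linear system. With compressors bypassed, the gas dynamics linearized about the nominal state have, up to terms not involving the state, the form $\dot{\boldsymbol\rho}=\Lambda^{-1}Q'X\varphi$, $\ \delta\dot\varphi=(\overline\alpha Q_\ell-\sigma^2L^{-1}Q)\boldsymbol\rho-\overline\beta\varphi$, where $\boldsymbol\rho$ is the vector of withdrawal-node densities, $\varphi$ the vector of edge inlet mass fluxes, $\delta\in\{0,1\}$, and $\overline\alpha$ and $-\overline\beta$ are the diagonal Jacobian matrices of the friction term with respect to edge density and flux, with $\overline\beta_{kk}=\lambda_k|\overline\varphi_k|/(D_k(Q_\ell\overline{\boldsymbol\rho})_k)$. Setting $\delta=0$ and $\overline\alpha=0$ and eliminating $\varphi$ gives a system in $\boldsymbol\rho$ alone with state matrix $\overline A=-\Lambda^{-1}(RQ)'RQ$. *)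

(* Defs.v *)
From mathcomp Require Import all_boot all_order all_algebra.
From mathcomp Require Import reals trigo.
From mathcomp Require Import complex.
Set Implicit Arguments.
Unset Strict Implicit.
Unset Printing Implicit Defensive.
Import Order.TTheory GRing.Theory Num.Theory.
Local Open Scope ring_scope.

(* Nodes are the elements of 'I_(Vs + Vw): [lshift Vw i] is the i-th supply
   node and [rshift Vs j] the j-th withdrawal node. Edge k is directed from
   [src k] to [tgt k]; parallel edges are allowed. *)
Section Graph.
Variables (E Vs Vw : nat) (src tgt : 'I_E -> 'I_(Vs + Vw)).

(* Adjacency in the underlying undirected graph: connectedness of the network
   ignores the edge orientations. *)
Definition adjacent : rel 'I_(Vs + Vw) := fun u v =>
  [exists k : 'I_E, ((src k == u) && (tgt k == v))
                 || ((src k == v) && (tgt k == u))].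

Definition connected_network : Prop :=
  forall u v : 'I_(Vs + Vw), connect adjacent u v.

Definition no_self_loops : Prop := forall k : 'I_E, src k != tgt k.

Definition supply_edges_outgoing : Prop :=
  forall (k : 'I_E) (i : 'I_Vs), tgt k != lshift Vw i.

End Graph.

Section Matrices.
Variables (R : realType) (E Vs Vw : nat) (src tgt : 'I_E -> 'I_(Vs + Vw)).
(* sigma : sound speed; len, diam, fric : lengths, diameters and friction
   factors of the edges; rho, phi : nominal withdrawal densities and fluxes. *)
Variables (sigma : R) (len diam fric : 'rV[R]_E).
Variables (rho : 'cV[R]_Vw) (phi : 'cV[R]_E).

(* Incidence matrix restricted to the withdrawal columns, all compressor ratios
   being 1. The order of the two tests matters only for self-loops. *)
Definition Qmx : 'M[R]_(E, Vw) :=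
  \matrix_(k, j) (if tgt k == rshift Vs j then 1
                  else if src k == rshift Vs j then -1 else 0).

Definition Qlmx : 'M[R]_(E, Vw) := map_mx (fun q => Num.max q 0) Qmx.

Definition Lmx : 'M[R]_E := diag_mx len.

Definition Xmx : 'M[R]_E := diag_mx (\row_k (pi * diam 0 k ^+ 2 / 4)).

Definition Lambdamx : 'M[R]_Vw := Qlmx^T *m Xmx *m Lmx *m Qlmx.

(* The diagonal is positive only when every flux phi k 0 is nonzero: division by
   0 yields 0. *)
Definition Rmx : 'M[R]_E :=
  diag_mx (\row_k Num.sqrt
    (sigma ^+ 2 * pi * diam 0 k ^+ 3 * (Qlmx *m rho) k 0
     / (4 * len 0 k * fric 0 k * `|phi k 0|))).

(* Meaningful only when Lambdamx is invertible, i.e. when every withdrawal node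
   has an entering edge: invmx is the identity on singular matrices. *)
Definition state_mx : 'M[R]_Vw :=
  - (invmx Lambdamx *m ((Rmx *m Qmx)^T *m (Rmx *m Qmx))).

End Matrices.

(* The eigenvalues are taken over the complex numbers. *)
Definition negative_real_eigenvalues (R : realType) (n : nat) (A : 'M[R]_n) :
    Prop :=
  forall z : R[i], eigenvalue (map_mx (real_complex R) A) z ->
    complex.Im z = 0 /\ complex.Re z < 0.

(* Main.v *)
(* If a row vector v satisfies v A = z v and w = v Lambda^-1, then
   w (RQ)'(RQ) w^* = - z (w Lambda w^* ). Both forms are weighted sums of squared
   moduli, hence nonnegative. The left one is positive: Q w' = 0 says that w,
   extended by 0 to the supply nodes, takes equal values at the ends of every
   edge, so by connectedness it vanishes. Hence z is a negative real. *)

Require Import Defs.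
From mathcomp Require Import all_boot all_order all_algebra.
From mathcomp Require Import reals trigo.
From mathcomp Require Import complex.
Set Implicit Arguments.
Unset Strict Implicit.
Unset Printing Implicit Defensive.
Import Order.TTheory GRing.Theory Num.Theory.
Local Open Scope ring_scope.

(** Conjugation fixes the real matrix [B], so with [y = B w'] the form is [y'] times [diag_mx d]
    times the conjugate of [y]. This serves for both [Lambda] and [(RQ)'RQ]. *)
Lemma hermitian_formE (R : rcfType) (m n : nat) (B : 'M[R]_(m, n))
    (d : 'rV[R]_m) (w : 'rV[R[i]]_n) :
  (w *m map_mx (real_complex R) (B^T *m diag_mx d *m B)
     *m (map_mx Num.conj w)^T) 0 0
  = \sum_k real_complex R (d 0 k)
      * `|(map_mx (real_complex R) B *m w^T) k 0| ^+ 2.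
Proof.
set f := real_complex R.
have fconj x : Num.conj (f x) = f x.
  by apply/CrealP; rewrite complex_real.
set y := map_mx f B *m w^T.
rewrite !map_mxM -map_trmx map_diag_mx !mulmxA.
have -> : w *m (map_mx f B)^T = y^T by rewrite trmx_mul trmxK.
rewrite -mulmxA.
have -> : map_mx f B *m (map_mx Num.conj w)^T = map_mx Num.conj y.
  rewrite map_mxM -map_trmx; congr (_ *m _).
  by apply/matrixP => i j; rewrite !mxE; exact/esym/fconj.
rewrite mul_mx_diag mxE; apply: eq_bigr => k _.
by rewrite !mxE normCK mulrCA mulrA.
Qed.

Section Network.
Variables (E Vs Vw : nat) (src tgt : 'I_E -> 'I_(Vs + Vw)).

Lemma connected_network_const (T : Type) (p : 'I_(Vs + Vw) -> T) :
  connected_network src tgt -> (forall k, p (src k) = p (tgt k)) ->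
  forall u v, p u = p v.
Proof.
move=> conn pE u v; have /connectP[s + ->] := conn u v.
elim: s u => //= x s IHs u /andP[/existsP[k adj] /IHs <-].
by case/orP: adj => /andP[/eqP <- /eqP <-]; rewrite pE.
Qed.

(* Extension by 0 to the supply nodes. *)
Definition grounded_potential (V : nmodType) (u : 'cV[V]_Vw)
    (x : 'I_(Vs + Vw)) : V :=
  match split x with inl _ => 0 | inr j => u j 0 end.

Lemma grounded_potential_lshift (V : nmodType) (u : 'cV[V]_Vw) i :
  grounded_potential u (lshift Vw i) = 0.
Proof. by rewrite /grounded_potential (unsplitK (inl _ i)). Qed.

Lemma grounded_potential_rshift (V : nmodType) (u : 'cV[V]_Vw) j :
  grounded_potential u (rshift Vs j) = u j 0.
Proof. by rewrite /grounded_potential (unsplitK (inr _ j)). Qed.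

Lemma grounded_potentialE (A : pzSemiRingType) (u : 'cV[A]_Vw) x :
  grounded_potential u x = \sum_j (x == rshift Vs j)%:R * u j 0.
Proof.
case: (split_ordP x) => [i ->|j ->].
  rewrite grounded_potential_lshift big1 // => j _.
  by rewrite eq_lrshift mul0r.
rewrite grounded_potential_rshift (bigD1 j) //= eqxx mul1r big1 ?addr0 //.
by move=> j' ne; rewrite eq_rshift eq_sym (negbTE ne) mul0r.
Qed.

(** [Q] acts as a discrete gradient: its missing supply columns are accounted for by grounding those
    nodes at 0. The morphism [f] allows complex potentials. *)
Lemma map_QmxE (R : realType) (A : pzRingType) (f : {rmorphism R -> A})
    (u : 'cV[A]_Vw) k : no_self_loops src tgt ->
  (map_mx f (Qmx R src tgt) *m u) k 0
  = grounded_potential u (tgt k) - grounded_potential u (src k).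
Proof.
move=> noloop; rewrite !grounded_potentialE -sumrB mxE.
apply: eq_bigr => j _; rewrite -mulrBl !mxE; congr (_ * _).
case: eqP => [tE|_]; last by case: eqP; rewrite /= ?rmorphN1 ?rmorph0 sub0r ?oppr0.
(* On a self-loop the entry would be 1, whereas the difference of potentials is 0. *)
have -> : (src k == rshift Vs j) = false by rewrite -tE; apply/negbTE/noloop.
by rewrite rmorph1 subr0.
Qed.

Lemma Qlmx_mulE (R : realType) (u : 'cV[R]_Vw) k :
  (Qlmx R src tgt *m u) k 0 = grounded_potential u (tgt k).
Proof.
rewrite grounded_potentialE mxE; apply: eq_bigr => j _; rewrite !mxE.
congr (_ * _); case: ifP => _; first by rewrite max_l.
by case: ifP => _; rewrite ?maxxx // max_r // oppr_le0.
Qed.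

(** Edges at supply nodes point outwards, so every head is a withdrawal node. This makes the
    densities under the square root in [Rmx] positive. *)
Lemma Qlmx_mul_gt0 (R : realType) (u : 'cV[R]_Vw) k :
  supply_edges_outgoing tgt -> (forall j, 0 < u j 0) ->
  0 < (Qlmx R src tgt *m u) k 0.
Proof.
move=> supply_out u_gt0; rewrite Qlmx_mulE.
case: (split_ordP (tgt k)) => [i tE|j ->].
  by have := supply_out k i; rewrite tE eqxx.
by rewrite grounded_potential_rshift.
Qed.

(** A potential with zero gradient is constant on a connected network, and its value at any supply
    node is 0. *)
Lemma map_Qmx_inj (R : realType) (A : pzRingType) (f : {rmorphism R -> A})
    (u : 'cV[A]_Vw) :
  (0 < Vs)%N -> connected_network src tgt -> no_self_loops src tgt ->
  (forall k, (map_mx f (Qmx R src tgt) *m u) k 0 = 0) -> u = 0.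
Proof.
move=> Vs_gt0 conn noloop Qu0; apply/colP => j; rewrite mxE.
rewrite -grounded_potential_rshift.
rewrite -(grounded_potential_lshift u (Ordinal Vs_gt0)).
apply: connected_network_const conn _ _ _ => k.
by apply/esym/subr0_eq; rewrite -(map_QmxE f u k noloop).
Qed.

End Network.

Theorem theorem1 (R : realType) (E Vs Vw : nat)
    (src tgt : 'I_E -> 'I_(Vs + Vw))
    (sigma : R) (len diam fric : 'rV[R]_E)
    (rho : 'cV[R]_Vw) (phi : 'cV[R]_E)
    (Vs_gt0 : (0 < Vs)%N) (Vw_gt0 : (0 < Vw)%N)
    (conn : connected_network src tgt)
    (noloop : no_self_loops src tgt)
    (supply_out : supply_edges_outgoing tgt)
    (sigma_gt0 : 0 < sigma)
    (len_gt0 : forall k, 0 < len 0 k)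
    (diam_gt0 : forall k, 0 < diam 0 k)
    (fric_gt0 : forall k, 0 < fric 0 k)
    (rho_gt0 : forall j, 0 < rho j 0)
    (phi_neq0 : forall k, phi k 0 != 0)
    (Lambda_inv : Lambdamx src tgt len diam \in unitmx) :
  negative_real_eigenvalues (state_mx src tgt sigma len diam fric rho phi).
Proof.
set f := real_complex R.
set r := \row_k Num.sqrt (sigma ^+ 2 * pi * diam 0 k ^+ 3
  * (Qlmx R src tgt *m rho) k 0 / (4 * len 0 k * fric 0 k * `|phi k 0|)).
have r_gt0 k : 0 < r 0 k.
  rewrite mxE sqrtr_gt0 divr_gt0 ?mulr_gt0 ?exprn_gt0 ?pi_gt0 ?ltr0n //.
    exact: Qlmx_mul_gt0.
  by rewrite normr_gt0.
set La := Lambdamx src tgt len diam in Lambda_inv *.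
(* The diagonal of [X L]; merging the two factors puts [La] in the shape required by
   [hermitian_formE]. The same is done below for [M], with weights [R^2]. *)
pose a := \row_k (pi * diam 0 k ^+ 2 / 4 * len 0 k).
have LaE : La = (Qlmx R src tgt)^T *m diag_mx a *m Qlmx R src tgt.
  rewrite /La /Lambdamx /Xmx /Lmx -(mulmxA _ (diag_mx _)) mulmx_diag.
  by congr (_ *m diag_mx _ *m _); apply/rowP => k; rewrite !mxE.
pose M := (Qmx R src tgt)^T *m diag_mx (\row_k (r 0 k * r 0 k)) *m Qmx R src tgt.
have AE : state_mx src tgt sigma len diam fric rho phi = - (invmx La *m M).
  rewrite /state_mx /Rmx -/r /M -mulmx_diag trmx_mul tr_diag_mx.
  by congr (- (_ *m _)); rewrite !mulmxA.
move=> z /eigenvalueP[v vA v_neq0].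
pose w := v *m map_mx f (invmx La).
(* Invertibility of [La] turns the eigenvalue equation into the generalized one [w M = - z w La]. *)
have vE : v = w *m map_mx f La by rewrite -mulmxA -map_mxM mulVmx // map_mx1 mulmx1.
have w_neq0 : w != 0.
  by apply: contraNneq v_neq0 => w0; rewrite vE w0 mul0mx.
pose q (B : 'M[R]_Vw) := (w *m map_mx f B *m (map_mx Num.conj w)^T) 0 0.
have qE : q M = - (z * q La).
  have wM : w *m map_mx f M = - (z *: (w *m map_mx f La)).
    by rewrite -vE -vA AE map_mxN (map_mxM _ (invmx La)) mulmxN opprK mulmxA.
  by rewrite /q wM mulNmx -scalemxAl !mxE.
have qLa_ge0 : 0 <= q La.
  rewrite /q LaE hermitian_formE sumr_ge0 // => k _.
  rewrite mulr_ge0 ?exprn_ge0 // ler0c mxE.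
  by rewrite ltW // !mulr_gt0 ?exprn_gt0 ?pi_gt0 ?invr_gt0 ?ltr0n.
have term_ge0 k : 0 <= f ((\row_i (r 0 i * r 0 i)) 0 k)
    * `|(map_mx f (Qmx R src tgt) *m w^T) k 0| ^+ 2.
  by rewrite mulr_ge0 ?exprn_ge0 // ler0c mxE ltW // mulr_gt0.
have qM_gt0 : 0 < q M.
  rewrite /q hermitian_formE lt0r sumr_ge0 ?andbT //.
  (* If the sum vanished, so would each term; the weights being positive, this forces [Q w' = 0]. *)
  apply: contra w_neq0; rewrite psumr_eq0 // => /allP all0.
  rewrite -(inj_eq trmx_inj) trmx0; apply/eqP.
  apply: (map_Qmx_inj (f := f) Vs_gt0 conn noloop) => k.
  have /eqP := implyP (all0 k (mem_index_enum k)) isT.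
  move/eqP; rewrite mulf_eq0 expf_eq0 /= normr_eq0 => /orP[|/eqP //].
  by rewrite fmorph_eq0 mxE mulf_eq0 orbb gt_eqF.
have zq_lt0 : z * q La < 0 by rewrite -oppr_gt0 -qE.
(* Strictness comes from the product: [q La = 0] would contradict [z * q La < 0]. *)
have qLa_gt0 : 0 < q La.
  rewrite lt0r qLa_ge0 andbT; apply: contraTneq zq_lt0 => ->.
  by rewrite mulr0 ltxx.
have : z < 0 by rewrite -(pmulr_llt0 _ qLa_gt0).
(* In the partial order on [R[i]], [z < 0] already includes that [z] is real. *)
by rewrite ltcE /= => /andP[/eqP <- ->].
Qed.
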